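(* Let $n\ge 2$ and let $P=P_1\otimes P_2\otimes\cdots\otimes P_n$ be an $n$-qubit Pauli string, with each $P_k\in\{I,X,Y,Z\}$. Assume $P_n\neq I$ and $P_j\neq I$ for at least one $j<n$. Let $\theta\in\mathbb{R}$ be such that the rotation $$e^{-i\theta P}=\alpha I+\beta P,\qquad \alpha=\cos\theta,\ \beta=-i\sin\theta,$$ is not a Clifford unitary. Let $|\phi_n\rangle\in\mathbb{C}^2$ be a single-qubit state. Then the following are equivalent: (i) There exists an $n$-qubit Clifford unitary $\mathcal{U}$ such that, for every $(n-1)$-qubit state $|\Psi\rangle$, the state $\mathcal{U}\,e^{-i\theta P}\big(|\Psi\rangle\otimes|\phi_n\rangle\big)$ is a product state $|\tilde\Psi\rangle\otimes|\tilde\phi_n\rangle$ with respect to the bipartition (first $n-1$ qubits) $|$ (qubit $n$). (ii) $|\phi_n\rangle$ is a single-qubit stabilizer state.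
   Context: The $n$-qubit Clifford group is the group of unitaries (up to global phase) that map the set of $n$-qubit Pauli strings to itself under conjugation. A stabilizer state is a state of the form $C|0\rangle^{\otimes m}$ with $C$ a Clifford unitary. For a single qubit, the stabilizer states are exactly the six eigenstates of $X$, $Y$ and $Z$, up to global phase. Here $X,Y,Z$ are the Pauli matrices and $I$ is the $2\times 2$ identity matrix. *)

(* Defs.v *)
From Stdlib Require Import Reals.
From mathcomp Require Import all_boot all_order all_algebra.
From mathcomp Require Import Rstruct.
From mathcomp.real_closed Require Import complex mxtens.

Set Implicit Arguments.
Unset Strict Implicit.
Unset Printing Implicit Defensive.

Import GRing.Theory Num.Theory.
Local Open Scope ring_scope.
Local Open Scope complex_scope.

Notation C := (R[i]).

Inductive pauli := PauliI | PauliX | PauliY | PauliZ.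

Definition pmx (p : pauli) : 'M[C]_2 :=
  match p with
  | PauliI => 1%:M
  | PauliX => \matrix_(i < 2, j < 2) (if i == j then 0 else 1)
  | PauliY => \matrix_(i < 2, j < 2)
            (if i == j then 0 else if (i == 0 :> nat) then - 'i else 'i)
  | PauliZ => \matrix_(i < 2, j < 2)
            (if i == j then (if (i == 0 :> nat) then 1 else -1) else 0)
  end.

(* Kronecker product P_1 (x) P_2 (x) ... (x) P_k; the first qubit is the most
   significant tensor factor (standard Kronecker convention of tensmx). *)
Fixpoint pauli_mx (s : seq pauli) : 'M[C]_(2 ^ size s) :=
  match s return 'M[C]_(2 ^ size s) with
  | [::] => 1%:M
  | p :: s' =>
      let e := esym (expnS 2 (size s')) in castmx (e, e) (pmx p *t pauli_mx s')
  end.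

Definition pstring (n : nat) (P : n.-tuple pauli) : 'M[C]_(2 ^ n) :=
  let e := congr1 (expn 2) (size_tuple P) in castmx (e, e) (pauli_mx P).

Definition adj (m n : nat) (A : 'M[C]_(m, n)) : 'M[C]_(n, m) :=
  (map_mx (@conjc R) A)^T.

Definition unitary (d : nat) (U : 'M[C]_d) : Prop := U *m adj U = 1%:M.

Definition clifford (n : nat) (U : 'M[C]_(2 ^ n)) : Prop :=
  unitary U /\
  forall Q : n.-tuple pauli, exists (k : nat) (Q' : n.-tuple pauli),
    U *m pstring Q *m adj U = ('i ^+ k) *: pstring Q'.

Definition is_state (d : nat) (v : 'cV[C]_d) : Prop := adj v *m v = 1%:M.

Definition kron (m : nat) (Psi : 'cV[C]_(2 ^ m)) (phi : 'cV[C]_2)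
  : 'cV[C]_(2 ^ m.+1) :=
  castmx (esym (expnSr 2 m), muln1 1) (Psi *t phi).

Definition product_state (m : nat) (v : 'cV[C]_(2 ^ m.+1)) : Prop :=
  exists (Psi : 'cV[C]_(2 ^ m)) (phi : 'cV[C]_2), v = kron Psi phi.

Definition ket0 : 'cV[C]_(2 ^ 1) := \col_(i < 2 ^ 1) (if (i == 0 :> nat) then 1 else 0).

Definition stabilizer_state1 (phi : 'cV[C]_2) : Prop :=
  exists U : 'M[C]_(2 ^ 1), clifford U /\ phi = U *m ket0.

(* the rotation e^{-i theta P} = cos theta I - i sin theta P *)
Definition pauli_rot (n : nat) (theta : R) (P : n.-tuple pauli) : 'M[C]_(2 ^ n) :=
  (cos theta)%:C *: 1%:M + (- 'i * (sin theta)%:C) *: pstring P.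

(* Main.v *)
(* Write P = P' (x) sigma, where sigma acts on the last qubit.

   (ii) => (i): a stabilizer state is an eigenvector p phi = r phi of a Pauli
   matrix p, with r = 1 or -1.  If p = sigma, the rotation already factors.
   Otherwise phi and sigma phi are orthogonal eigenvectors of p, and the
   controlled Pauli (1 + A + B - AB) / 2, with A = 1 (x) r p and B = P' (x) 1,
   undoes P' on the sigma phi branch.

   (i) => (ii): the isometry Psi |-> U e^(-i theta P) (Psi (x) phi) has only
   product vectors in its range, so its range is either C^(2^m) (x) w, or
   u (x) C^2 with m = 1.  In both cases, if Q is a Pauli string with
   tr (Q e^(-i theta P) (1 (x) phi phi^* ) e^(i theta P)) != 0, then U Q U^*
   belongs to one fixed copy of M_2 in M_(2^n).  If phi had nonzero Bloch
   components along two axes a and b, with b != sigma, then this would apply to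
   1 (x) a, 1 (x) b and (1 (x) b) P, the last one because sin (2 theta) != 0.
   Then P, 1 (x) a, 1 (x) b and their products would all land in that copy of
   M_2, where orthogonality for the trace form makes this impossible.  Hence phi
   has a single Bloch axis. *)
Require Import Defs.
From Stdlib Require Import Reals.
From mathcomp Require Import all_boot all_order all_algebra.
From mathcomp Require Import Rstruct.
From mathcomp.real_closed Require Import complex mxtens.
From mathcomp Require Import ring.
Import GRing.Theory Num.Theory.
Local Open Scope ring_scope.
Local Open Scope complex_scope.

Local Notation C := (R[i]).

Set Implicit Arguments.
Unset Strict Implicit.
Unset Printing Implicit Defensive.

(** * Adjoints, and Kronecker products up to a change of size *)

Lemma adjmxM a b c (A : 'M[C]_(a, b)) (B : 'M[C]_(b, c)) :
  adj (A *m B) = adj B *m adj A.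
Proof. by rewrite /adj map_mxM trmx_mul. Qed.

Lemma adjmxD a b (A B : 'M[C]_(a, b)) : adj (A + B) = adj A + adj B.
Proof. by rewrite /adj map_mxD raddfD. Qed.

Lemma adjmxZ a b (c : C) (A : 'M[C]_(a, b)) : adj (c *: A) = conjc c *: adj A.
Proof. by rewrite /adj map_mxZ linearZ. Qed.

Lemma adjmx1 a : adj (1%:M : 'M[C]_a) = 1%:M.
Proof. by rewrite /adj map_mx1 trmx1. Qed.

Lemma adj_cast a b a' b' (e : a = a') (f : b = b') (A : 'M[C]_(a, b)) :
  adj (castmx (e, f) A) = castmx (f, e) (adj A).
Proof. by case: a' / e; case: b' / f. Qed.

Lemma adj_tens a b c d (A : 'M[C]_(a, b)) (B : 'M[C]_(c, d)) :
  adj (A *t B) = adj A *t adj B.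
Proof. by rewrite /adj map_mxT trmx_tens. Qed.

Lemma mxtrace_tens a b (A : 'M[C]_a) (B : 'M[C]_b) :
  \tr (A *t B) = \tr A * \tr B.
Proof.
rewrite /mxtrace mulr_sum; apply: eq_bigr => i _.
by rewrite !mxE.
Qed.

Lemma tens1mx1 a b : (1%:M : 'M[C]_a) *t (1%:M : 'M[C]_b) = 1%:M.
Proof.
apply/matrixP => i j.
case: (mxtens_indexP i) => [i1 i2]; case: (mxtens_indexP j) => [j1 j2].
rewrite tensmxE !mxE -natrM mulnb; congr (_%:R); congr nat_of_bool.
by rewrite (can_eq (@mxtens_indexK _ _)).
Qed.

(* Equality of square matrices whose sizes are only propositionally equal. *)
Definition mxsim a b (A : 'M[C]_a) (B : 'M[C]_b) :=
  exists e : a = b, castmx (e, e) A = B.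

Lemma mxsim_refl a (A : 'M[C]_a) : mxsim A A.
Proof. by exists erefl. Qed.

Lemma mxsim_sym a b (A : 'M[C]_a) (B : 'M[C]_b) : mxsim A B -> mxsim B A.
Proof. by case=> e <-; case: b / e B => B; exists erefl. Qed.

Lemma mxsim_trans a b c (B : 'M[C]_b) (A : 'M[C]_a) (D : 'M[C]_c) :
  mxsim A B -> mxsim B D -> mxsim A D.
Proof. by case=> e <-; case: b / e B => _ [f <-]; exists f. Qed.

Lemma mxsim_cast a b (e : a = b) (A : 'M[C]_a) : mxsim A (castmx (e, e) A).
Proof. by exists e. Qed.

Lemma mxsim_eq a (A B : 'M[C]_a) : mxsim A B -> A = B.
Proof. by case=> e <-; rewrite (eq_irrelevance e erefl). Qed.

Lemma mxsim_tens a b c d (A : 'M[C]_a) (B : 'M[C]_b) (X : 'M[C]_c) (Y : 'M[C]_d) :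
  mxsim A B -> mxsim X Y -> mxsim (A *t X) (B *t Y).
Proof.
case=> e <- [f <-]; case: b / e B => _; case: d / f Y => _.
exact: mxsim_refl.
Qed.

Lemma mxsim_tensA a b c (A : 'M[C]_a) (B : 'M[C]_b) (X : 'M[C]_c) :
  mxsim (A *t (B *t X)) (A *t B *t X).
Proof.
exists (mulnA a b c); apply/matrixP => i j; rewrite castmxE !mxE mulrA.
have E1 k : (k %/ (b * c) = k %/ c %/ b)%N by rewrite mulnC divnMA.
have E2 k : (k %% (b * c) %/ c = (k %/ c) %% b)%N by rewrite modn_divl.
have E3 k : (k %% (b * c) %% c = k %% c)%N by rewrite modn_dvdm ?dvdn_mull.
by congr (A _ _ * B _ _ * X _ _); apply: val_inj; rewrite /= ?E1 ?E2 ?E3.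
Qed.

(** [pauli_mx] splits off the first factor, whereas the bipartition singles out the last one;
    associativity of the Kronecker product passes from one to the other. *)
Lemma mxsim_rcons (s : seq pauli) (p : pauli) :
  mxsim (pauli_mx (rcons s p)) (pauli_mx s *t pmx p).
Proof.
elim: s => [|q s IH] /=.
  apply: mxsim_trans (mxsim_sym (mxsim_cast _ _)) _.
  by rewrite tens_scalar1mx tens_mx_scalar scale1r;
    apply: mxsim_trans (mxsim_sym (mxsim_cast _ _)) (mxsim_cast _ _).
apply: mxsim_trans (mxsim_sym (mxsim_cast _ _)) _.
apply: mxsim_trans (mxsim_tens (mxsim_refl _) IH) _.
apply: mxsim_trans (mxsim_tensA _ _ _) _.
exact: mxsim_tens (mxsim_cast _ _) (mxsim_refl _).
Qed.

(** * Kronecker products whose second factor is the last qubit *)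

(** The column count [N] comes with its own equation [e], so that one operation covers operators,
    [kron], and the shapes [k * 1] and [1 * k] of an isometry with a constant factor. *)
Definition krmx m k l N (e : (k * l)%N = N) (X : 'M[C]_(2 ^ m, k)) (Y : 'M[C]_(2, l))
  : 'M[C]_(2 ^ m.+1, N) := castmx (esym (expnSr 2 m), e) (X *t Y).

Definition kr2 m (X : 'M[C]_(2 ^ m)) (Y : 'M[C]_2) : 'M[C]_(2 ^ m.+1) :=
  krmx (esym (expnSr 2 m)) X Y.

Lemma pstring_rcons m (P : m.-tuple pauli) (p : pauli) :
  pstring (rcons_tuple P p) = kr2 (pstring P) (pmx p).
Proof.
apply: mxsim_eq; rewrite /pstring.
apply: mxsim_trans (mxsim_sym (mxsim_cast _ _)) _.
apply: mxsim_trans (mxsim_rcons _ _) _.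
apply: (mxsim_trans (B := pstring P *t pmx p)); last exact: mxsim_cast.
exact: mxsim_tens (mxsim_cast _ _) (mxsim_refl _).
Qed.

Lemma tuple_rcons m (P : m.+1.-tuple pauli) :
  exists P' : m.-tuple pauli, P = rcons_tuple P' (tnth P ord_max) /\
    forall i : 'I_m, tnth P' i = tnth P (widen_ord (leqnSn m) i).
Proof.
exists [tuple tnth P (widen_ord (leqnSn m) i) | i < m]; split; last first.
  by move=> i; rewrite tnth_mktuple.
apply: eq_from_tnth => i; rewrite [RHS](tnth_nth PauliI) /= nth_rcons size_map size_enum_ord.
have := ltn_ord i; rewrite ltnS leq_eqVlt => /orP[/eqP im|im]; last first.
  rewrite im (nth_map (Ordinal im)) ?size_enum_ord //.
  by congr tnth; apply: val_inj; rewrite /= nth_enum_ord.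
by rewrite im ltnn eqxx; congr tnth; apply: val_inj.
Qed.

(** Induction that peels off the last qubit, to be combined with [pstring_rcons]. *)
Lemma pstring_ind (K : forall n, n.-tuple pauli -> Prop) :
  K 0 [tuple] -> (forall n (P : n.-tuple pauli) p, K n P -> K n.+1 (rcons_tuple P p)) ->
  forall n (P : n.-tuple pauli), K n P.
Proof.
move=> K0 KS; elim=> [|n IH] P; first by rewrite (tuple0 P).
by have [P' [-> _]] := tuple_rcons P; apply: KS.
Qed.

Lemma pstring0 : pstring [tuple] = 1%:M.
Proof. by rewrite /pstring /= (eq_irrelevance (congr1 _ _) erefl). Qed.

Section Kr.
Variable m : nat.

Lemma kr2_krmx k l N (e : (k * l)%N = N) A B (X : 'M[C]_(2 ^ m, k)) (Y : 'M[C]_(2, l)) :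
  kr2 A B *m krmx e X Y = krmx e (A *m X) (B *m Y).
Proof.
rewrite /kr2 /krmx -tensmx_mul; case: N / e.
by case: _ / (esym (expnSr 2 m)).
Qed.

Lemma krmx_cast k l N (e : (k * l)%N = N) k' l' N' (e' : (k' * l')%N = N')
    (X : 'M[C]_(2 ^ m, k)) (Y : 'M[C]_(2, l)) (Z : 'M[C]_(k, k')) (T : 'M[C]_(l, l')) :
  krmx e X Y *m castmx (e, e') (Z *t T) = krmx e' (X *m Z) (Y *m T).
Proof.
rewrite /krmx -tensmx_mul; case: N / e; case: N' / e'.
by case: _ / (esym (expnSr 2 m)).
Qed.

Lemma krmx_mulr k k' (X : 'M[C]_(2 ^ m, k)) (w : 'cV[C]_2) (Z : 'M[C]_(k, k')) :
  krmx (muln1 k) X w *m Z = krmx (muln1 k') (X *m Z) w.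
Proof.
rewrite -[in RHS](mulmx1 w) -(krmx_cast (muln1 k)) tens_mx_scalar scale1r castmx_comp.
by rewrite (eq_irrelevance (etrans _ _) erefl) (eq_irrelevance (etrans _ _) erefl) castmx_id.
Qed.

Lemma krmx_mull k k' (u : 'cV[C]_(2 ^ m)) (W : 'M[C]_(2, k)) (Z : 'M[C]_(k, k')) :
  krmx (mul1n k) u W *m Z = krmx (mul1n k') u (W *m Z).
Proof.
rewrite -[in RHS](mulmx1 u) -(krmx_cast (mul1n k)) tens_scalar_mx scale1r castmx_comp.
by rewrite (eq_irrelevance (etrans _ _) erefl) (eq_irrelevance (etrans _ _) erefl) castmx_id.
Qed.

Lemma adj_krmx k l N (e : (k * l)%N = N) k' l' N' (e' : (k' * l')%N = N')
    (X : 'M[C]_(2 ^ m, k)) (Y : 'M[C]_(2, l)) (X' : 'M[C]_(2 ^ m, k')) (Y' : 'M[C]_(2, l')) :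
  adj (krmx e X Y) *m krmx e' X' Y' =
  castmx (e, e') ((adj X *m X') *t (adj Y *m Y')).
Proof.
rewrite /krmx -tensmx_mul -adj_tens adj_cast; case: N / e; case: N' / e'.
by case: _ / (esym (expnSr 2 m)).
Qed.

Lemma krmx_adj k l N (e : (k * l)%N = N)
    (X X' : 'M[C]_(2 ^ m, k)) (Y Y' : 'M[C]_(2, l)) :
  krmx e X Y *m adj (krmx e X' Y') = kr2 (X *m adj X') (Y *m adj Y').
Proof.
rewrite /kr2 /krmx -tensmx_mul -adj_tens adj_cast; case: N / e.
by case: _ / (esym (expnSr 2 m)).
Qed.

Lemma kr2M A B A' B' : kr2 A B *m kr2 A' B' = @kr2 m (A *m A') (B *m B').
Proof. exact: kr2_krmx. Qed.

Lemma adj_kr2 A B : adj (@kr2 m A B) = kr2 (adj A) (adj B).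
Proof. by rewrite /kr2 /krmx adj_cast adj_tens. Qed.

Lemma mxtrace_kr2 A B : \tr (@kr2 m A B) = \tr A * \tr B.
Proof.
by rewrite -mxtrace_tens /kr2 /krmx; case: _ / (esym (expnSr 2 m)).
Qed.

Lemma kr21 : @kr2 m 1%:M 1%:M = 1%:M.
Proof. by rewrite /kr2 /krmx tens1mx1; case: _ / (esym (expnSr 2 m)). Qed.

Lemma krmxZl k l N (e : (k * l)%N = N) c (X : 'M[C]_(2 ^ m, k)) (Y : 'M[C]_(2, l)) :
  krmx e (c *: X) Y = c *: krmx e X Y.
Proof.
case: N / e; rewrite /krmx; case: _ / (esym (expnSr 2 m)).
by apply/matrixP=> i j; rewrite !castmx_id !mxE mulrA.
Qed.

Lemma krmxZr k l N (e : (k * l)%N = N) c (X : 'M[C]_(2 ^ m, k)) (Y : 'M[C]_(2, l)) :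
  krmx e X (c *: Y) = c *: krmx e X Y.
Proof.
case: N / e; rewrite /krmx; case: _ / (esym (expnSr 2 m)).
by apply/matrixP=> i j; rewrite !castmx_id !mxE mulrCA.
Qed.

Lemma krmxDr k l N (e : (k * l)%N = N) (X : 'M[C]_(2 ^ m, k)) (Y Y' : 'M[C]_(2, l)) :
  krmx e X (Y + Y') = krmx e X Y + krmx e X Y'.
Proof.
case: N / e; rewrite /krmx; case: _ / (esym (expnSr 2 m)).
by apply/matrixP=> i j; rewrite !castmx_id !mxE mulrDr.
Qed.

Lemma krmxDl k l N (e : (k * l)%N = N) (X X' : 'M[C]_(2 ^ m, k)) (Y : 'M[C]_(2, l)) :
  krmx e (X + X') Y = krmx e X Y + krmx e X' Y.
Proof.
case: N / e; rewrite /krmx; case: _ / (esym (expnSr 2 m)).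
by apply/matrixP=> i j; rewrite !castmx_id !mxE mulrDl.
Qed.

Lemma kronE u w : kron u w = krmx (m := m) (muln1 1) u w.
Proof. by []. Qed.

Lemma kr2_kron A B u w : kr2 A B *m kron u w = kron (m := m) (A *m u) (B *m w).
Proof. exact: kr2_krmx. Qed.
End Kr.

(** * Algebra of the single-qubit Pauli matrices *)

Lemma mx2P (A B : 'M[C]_2) : A 0 0 = B 0 0 -> A 0 1 = B 0 1 ->
  A 1 0 = B 1 0 -> A 1 1 = B 1 1 -> A = B.
Proof.
move=> e00 e01 e10 e11; apply/matrixP=> i j.
have o2 (k : 'I_2) : k = 0 \/ k = 1.
  by case: k => [[|[|]]] // k; [left | right]; apply: val_inj.
by have [-> | ->] := o2 i; have [-> | ->] := o2 j.
Qed.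

Lemma mulmx2E (A B : 'M[C]_2) i j : (A *m B) i j = A i 0 * B 0 j + A i 1 * B 1 j.
Proof.
rewrite mxE !big_ord_recl big_ord0 addr0.
by congr (_ + A i _ * B _ j); apply: val_inj.
Qed.

Lemma mxtrace2E (A : 'M[C]_2) : \tr A = A 0 0 + A 1 1.
Proof.
rewrite /mxtrace !big_ord_recl big_ord0 addr0.
by congr (_ + A _ _); apply: val_inj.
Qed.

(* [- 'i] parses to [Num.imaginary] and a bare ['i] to [Complex 0 1]; we
   normalize to the former. *)
Lemma sqri : 'i%R * 'i%R = -1 :> C.
Proof. by rewrite -complexiE -expr2 sqr_i. Qed.

Lemma conj_i : conjc ('i%R : C) = - 'i%R.
Proof. by rewrite -complexiE; apply/eqP; rewrite eq_complex /= oppr0 !eqxx. Qed.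

Ltac pauli_entries :=
  apply: mx2P; rewrite ?(mulmx2E, mxE) ?complexiE /= ?mulr1n ?mulr0n.

Lemma pmx_mul p q : exists k r, pmx p *m pmx q = 'i ^+ k *: pmx r.
Proof.
by case: p; case: q; [
  exists 0%N, PauliI | exists 0%N, PauliX | exists 0%N, PauliY | exists 0%N, PauliZ
| exists 0%N, PauliX | exists 0%N, PauliI | exists 1%N, PauliZ | exists 3%N, PauliY
| exists 0%N, PauliY | exists 3%N, PauliZ | exists 0%N, PauliI | exists 1%N, PauliX
| exists 0%N, PauliZ | exists 1%N, PauliY | exists 3%N, PauliX | exists 0%N, PauliI ];
pauli_entries; ring: sqri.
Qed.

Lemma adj_pmx p : adj (pmx p) = pmx p.
Proof.
by case: p; apply: mx2P; rewrite /adj !mxE -?complexiE; apply/eqP;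
  rewrite eq_complex /= ?oppr0 ?opprK !eqxx.
Qed.

Lemma pmx_sqr p : pmx p *m pmx p = 1%:M.
Proof. by case: p; pauli_entries; ring: sqri. Qed.

Lemma pmx_comm p q : exists2 e : C, e = 1 \/ e = -1 &
  pmx p *m pmx q = e *: (pmx q *m pmx p).
Proof.
by case: p; case: q; first [ by exists 1; [left | pauli_entries; ring: sqri]
  | by exists (-1); [right | pauli_entries; ring: sqri]].
Qed.

Lemma pmx_anticomm p q : p <> PauliI -> q <> PauliI -> p <> q ->
  pmx p *m pmx q = - (pmx q *m pmx p).
Proof. by case: p; case: q => // _ _ _; pauli_entries; ring: sqri. Qed.

Lemma mxtrace_pmx p : p <> PauliI -> \tr (pmx p) = 0.
Proof. by case: p => // _; rewrite mxtrace2E !mxE /=; ring. Qed.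

Lemma mxtrace_pmx_mul p q : p <> q -> \tr (pmx p *m pmx q) = 0.
Proof.
by case: p; case: q => // _; rewrite mxtrace2E !(mulmx2E, mxE) ?complexiE /= ?mulr1n ?mulr0n;
  ring: sqri.
Qed.

(** The Bloch decomposition, doubled to avoid a division. *)
Lemma pauli_expansion (A : 'M[C]_2) :
  2 *: A = (\tr A)%:M + \tr (pmx PauliX *m A) *: pmx PauliX +
    \tr (pmx PauliY *m A) *: pmx PauliY + \tr (pmx PauliZ *m A) *: pmx PauliZ.
Proof.
by apply: mx2P; rewrite !mxtrace2E !(mulmx2E, mxE) ?complexiE /= ?mulr1n ?mulr0n;
  ring: sqri.
Qed.

(** Polarized Cayley-Hamilton: a traceless 2 by 2 matrix squares to a scalar. *)
Lemma traceless_anticomm (A B : 'M[C]_2) : \tr A = 0 -> \tr B = 0 ->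
  A *m B + B *m A = (\tr (A *m B))%:M.
Proof.
rewrite !mxtrace2E => /eqP; rewrite addr_eq0 => /eqP eA /eqP; rewrite addr_eq0 => /eqP eB.
by apply: mx2P; rewrite !(mulmx2E, mxE) /= ?mulr1n ?mulr0n eA eB; ring.
Qed.

(** * Pauli strings and the Pauli group *)

Lemma adj_pstring n (P : n.-tuple pauli) : adj (pstring P) = pstring P.
Proof.
move: n P; apply: pstring_ind => [|n P p IH]; first by rewrite pstring0 adjmx1.
by rewrite pstring_rcons adj_kr2 IH adj_pmx.
Qed.

Lemma pstring_sqr n (P : n.-tuple pauli) : pstring P *m pstring P = 1%:M.
Proof.
move: n P; apply: pstring_ind => [|n P p IH]; first by rewrite pstring0 mulmx1.
by rewrite pstring_rcons kr2M IH pmx_sqr kr21.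
Qed.

Lemma pstring_mul n (P Q : n.-tuple pauli) :
  exists k S, pstring P *m pstring Q = 'i%R ^+ k *: @pstring n S.
Proof.
move: n P Q; apply: pstring_ind => [Q|n P p IH Q].
  by exists 0%N, Q; rewrite pstring0 mul1mx scale1r.
have [Q' [-> _]] := tuple_rcons Q.
have [k [S E]] := IH Q'; have [l [s e]] := pmx_mul p (tnth Q ord_max).
exists (k + l)%N, (rcons_tuple S s).
by rewrite !pstring_rcons kr2M E e /kr2 krmxZl krmxZr scalerA exprD.
Qed.

Lemma pstring_comm n (P Q : n.-tuple pauli) : exists2 e : C, e = 1 \/ e = -1 &
  pstring P *m pstring Q = e *: (pstring Q *m pstring P).
Proof.
move: n P Q; apply: pstring_ind => [Q|n P p IH Q].
  by exists 1; [left | rewrite pstring0 mul1mx mulmx1 scale1r].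
have [Q' [-> _]] := tuple_rcons Q.
have [e He E] := IH Q'; have [f Hf F] := pmx_comm p (tnth Q ord_max).
exists (e * f); last by rewrite !pstring_rcons !kr2M E F /kr2 krmxZl krmxZr scalerA.
by case: He => ->; case: Hf => ->; rewrite ?mulr1 ?mul1r ?mulrNN ?mulr1; [left|right|right|left].
Qed.

Lemma tnth_rcons_last n (P : n.-tuple pauli) p : tnth (rcons_tuple P p) ord_max = p.
Proof. by rewrite (tnth_nth PauliI) /= nth_rcons size_tuple ltnn eqxx. Qed.

Lemma mxtrace_pstring n (P : n.-tuple pauli) :
  \tr (pstring P) <> 0 -> forall i, tnth P i = PauliI.
Proof.
move: n P; apply: pstring_ind => [_ []|n P p IH] //.
rewrite pstring_rcons mxtrace_kr2 => nz i.
have pI : p = PauliI by case: p nz => // nz; case: nz; rewrite mxtrace_pmx // mulr0.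
have PI := IH (fun tr0 => nz (etrans (congr1 (fun x => x * _) tr0) (mul0r _))).
rewrite (tnth_nth PauliI) /= nth_rcons size_tuple; case: ltnP => [lt_in|_].
  by have := PI (Ordinal lt_in); rewrite (tnth_nth PauliI).
by rewrite pI if_same.
Qed.

Lemma pstringI n (P : n.-tuple pauli) : (forall i, tnth P i = PauliI) -> pstring P = 1%:M.
Proof.
move: n P; apply: pstring_ind => [|n P p IH PI]; first by rewrite pstring0.
have := PI ord_max; rewrite tnth_rcons_last => ->.
rewrite pstring_rcons IH ?kr21 // => i.
have := PI (widen_ord (leqnSn n) i).
by rewrite !(tnth_nth PauliI) /= nth_rcons size_tuple ltn_ord.
Qed.

Lemma pstring_nseqI n : pstring (nseq_tuple n PauliI) = 1%:M.
Proof. by apply: pstringI => i; rewrite (tnth_nth PauliI) /= nth_nseq ltn_ord. Qed.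

(** Membership in the Pauli group; unlike the set of bare strings, it is closed under products. *)
Definition phased_pauli n (X : 'M[C]_(2 ^ n)) :=
  exists k (Q : n.-tuple pauli), X = 'i%R ^+ k *: pstring Q.

Lemma phased_pstring n (P : n.-tuple pauli) : phased_pauli (pstring P).
Proof. by exists 0%N, P; rewrite expr0 scale1r. Qed.

Lemma phased_pauliM n (X Y : 'M[C]_(2 ^ n)) :
  phased_pauli X -> phased_pauli Y -> phased_pauli (X *m Y).
Proof.
case=> k [P ->] [l [Q ->]]; have [j [S E]] := pstring_mul P Q.
by exists (k + l + j)%N, S; rewrite -scalemxAl -scalemxAr E !scalerA !exprD.
Qed.

Lemma phased_pauliN n (X : 'M[C]_(2 ^ n)) : phased_pauli X -> phased_pauli (- X).
Proof.
by case=> k [P ->]; exists k.+2, P; rewrite !exprS mulrA sqri mulN1r scaleNr.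
Qed.

Lemma phased_pauliZ n (r : C) (X : 'M[C]_(2 ^ n)) :
  r = 1 \/ r = -1 -> phased_pauli X -> phased_pauli (r *: X).
Proof.
by case=> -> PX; [rewrite scale1r | rewrite scaleN1r; apply: phased_pauliN].
Qed.

Lemma clifford_conj n (U X : 'M[C]_(2 ^ n)) :
  clifford U -> phased_pauli X -> phased_pauli (U *m X *m adj U).
Proof.
case=> _ cU [k [Q ->]]; have [l [S E]] := cU Q.
by exists (k + l)%N, S; rewrite -scalemxAr -scalemxAl E scalerA exprD.
Qed.

Lemma phased_pauli_comm n (X : 'M[C]_(2 ^ n)) (Q : n.-tuple pauli) :
  phased_pauli X -> exists2 e : C, e = 1 \/ e = -1 &
  X *m pstring Q = e *: (pstring Q *m X).
Proof.
case=> k [P ->]; have [e He E] := pstring_comm P Q.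
by exists e => //; rewrite -scalemxAl -scalemxAr E !scalerA mulrC.
Qed.

(** * Controlled Pauli gates *)

Section Controlled.
Variables (n : nat) (A B : 'M[C]_n).
Hypotheses (A2 : A *m A = 1%:M) (B2 : B *m B = 1%:M) (AB : A *m B = B *m A).

(** Coordinates in the algebra generated by two commuting involutions, a quotient of the group
    algebra of [Z/2 x Z/2]; products of gates reduce to polynomial identities. *)
Definition span4 (p q r s : C) : 'M[C]_n :=
  p *: 1%:M + q *: A + r *: B + s *: (A *m B).

Lemma span4M p q r s p' q' r' s' :
  span4 p q r s *m span4 p' q' r' s' =
  span4 (p * p' + q * q' + r * r' + s * s') (p * q' + q * p' + r * s' + s * r')
        (p * r' + r * p' + q * s' + s * q') (p * s' + s * p' + q * r' + r * q').
Proof.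
have E1 : A *m (A *m B) = B by rewrite mulmxA A2 mul1mx.
have E2 : B *m (A *m B) = A by rewrite AB mulmxA B2 mul1mx.
have E3 : A *m B *m A = B by rewrite AB -mulmxA A2 mulmx1.
have E4 : A *m B *m B = A by rewrite -mulmxA B2 mulmx1.
have E5 : A *m B *m (A *m B) = 1%:M by rewrite mulmxA E3 B2.
rewrite /span4 !(mulmxDl, mulmxDr) -!scalemxAl -!scalemxAr !(mulmx1, mul1mx).
rewrite E5 E1 E2 E3 E4 A2 B2 -AB !scalerA.
by apply/matrixP=> i j; rewrite !mxE; ring.
Qed.
End Controlled.

(** This is [(1 + A) / 2 + (1 - A) / 2 * B]: the identity on the +1 eigenspace of [A], and [B] on
    the -1 eigenspace. *)
Definition controlled n (A B : 'M[C]_n) := span4 A B 2^-1 2^-1 2^-1 (- 2^-1).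

(** A Pauli string commutes with [A] and [B] up to signs [a] and [b]. Conjugating it multiplies it
    by an element of the span in which a single coefficient survives: 1, [A], [B] or [- A B],
    according to the signs. *)
Lemma clifford_controlled n (A B : 'M[C]_(2 ^ n)) :
  A *m A = 1%:M -> B *m B = 1%:M -> A *m B = B *m A ->
  adj A = A -> adj B = B -> phased_pauli A -> phased_pauli B ->
  clifford (controlled A B).
Proof.
move=> A2 B2 AB hA hB pA pB.
have conj_half : conjc (2^-1 : C) = 2^-1.
  by rewrite conjc_inv; congr (_^-1); exact: (conjc_nat R 2).
have hU : adj (controlled A B) = controlled A B.
  rewrite /controlled /span4 !adjmxD !adjmxZ adjmxM adjmx1 hA hB -AB.
  have -> : conjc (- 2^-1 : C) = - conjc 2^-1 by apply: rmorphN.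
  by rewrite conj_half.
(* The first factor is the gate after [Q] has been moved across it; [a = b = 1] gives unitarity. *)
have mulV a b : span4 A B 2^-1 (2^-1 * a) (2^-1 * b) (- 2^-1 * b * a) *m controlled A B =
   span4 A B (2^-1 * 2^-1 * ((1 + a) * (1 + b))) (2^-1 * 2^-1 * ((1 + a) * (1 - b)))
     (2^-1 * 2^-1 * ((1 - a) * (1 + b))) (- (2^-1 * 2^-1 * ((1 - a) * (1 - b)))).
  by rewrite span4M //; move: (2^-1) => h; congr span4; ring.
split.
  rewrite /unitary hU; have := mulV 1 1; rewrite !mulr1 => ->.
  rewrite /span4 subrr !(mulr0, mul0r) oppr0 !scale0r !addr0.
  by rewrite -[RHS]scale1r; congr (_ *: _); field.
move=> Q.
have [a Ha EA] := phased_pauli_comm Q pA; have [b Hb EB] := phased_pauli_comm Q pB.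
have -> : controlled A B *m pstring Q *m adj (controlled A B) =
   pstring Q *m (span4 A B 2^-1 (2^-1 * a) (2^-1 * b) (- 2^-1 * b * a) *m controlled A B).
  rewrite hU mulmxA; congr (_ *m _).
  rewrite /controlled /span4 !mulmxDl !mulmxDr -!scalemxAl -!scalemxAr.
  rewrite -mulmxA EB -scalemxAr [A *m (_ *m _)]mulmxA EA -scalemxAl !scalerA mul1mx mulmx1.
  by rewrite mulmxA.
rewrite mulV; apply: (@phased_pauliM _ (pstring Q)); first exact: phased_pstring.
have quarter : 2^-1 * 2^-1 * (2 * 2) = 1 :> C by field.
have one2 : 1 + 1 = 2 :> C by [].
case: Ha => ->; case: Hb => ->;
  rewrite /span4 ?opprK !subrr !(mulr0, mul0r) ?oppr0 !scale0r
    !(addr0, add0r) one2 quarter ?scaleN1r ?scale1r //.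
- by rewrite -pstring_nseqI; exact: phased_pstring.
- exact: phased_pauliN (phased_pauliM pA pB).
Qed.

(** * Single-qubit stabilizer states, and disentangling by a controlled Pauli *)

Lemma pauli_eq_dec (p q : pauli) : {p = q} + {p <> q}.
Proof. by case: p; case: q; first [by left | by right]. Qed.

Lemma pstring1 (Q : 1.-tuple pauli) : pstring Q = pmx (tnth Q ord0) :> 'M[C]_2.
Proof.
case/tupleP: Q => q t; rewrite (tuple0 t) tnth0.
apply: mxsim_eq; rewrite /pstring.
apply: mxsim_trans (mxsim_sym (mxsim_cast _ _)) _.
apply: mxsim_trans (mxsim_sym (mxsim_cast _ _)) _.
rewrite tens_mx_scalar scale1r; apply: mxsim_sym; exact: mxsim_cast.
Qed.

Lemma stabilizer_eigen (phi : 'cV[C]_2) : stabilizer_state1 phi ->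
  exists p (r : C), [/\ p <> PauliI, r = 1 \/ r = -1 & pmx p *m phi = r *: phi].
Proof.
case=> U [[uU cU] def_phi].
(* [Z] fixes [ket0], so its conjugate by [U] is a phased Pauli matrix that fixes [phi]. *)
have [k [Q E]] := cU [tuple PauliZ]; rewrite !pstring1 in E.
have uU' : adj U *m U = 1%:M := mulmx1C uU.
set r := 'i%R ^+ k in E; set q := tnth Q ord0 in E.
have Zket : pmx PauliZ *m ket0 = ket0.
  apply/matrixP => i j; rewrite mxE !big_ord_recl big_ord0 !mxE /=.
  by case: i => [[|[|]]] //= _; ring.
have Eq : r *: pmx q *m phi = phi.
  by rewrite -E def_phi -!mulmxA [adj U *m _]mulmxA uU' mul1mx Zket.
(* [Z] and [q] are both involutions, which forces the phase to square to 1. *)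
have r2 : (r * r) *: (1%:M : 'M[C]_2) = 1%:M.
  rewrite -(pmx_sqr q) -scalerA scalemxAr scalemxAl -E pmx_sqr.
  rewrite -!mulmxA [adj U *m (U *m _)]mulmxA uU' mul1mx.
  by rewrite [pmx _ *m (pmx _ *m _)]mulmxA pmx_sqr mul1mx.
have rr : r ^+ 2 = 1 by have /matrixP/(_ 0 0) := r2; rewrite !mxE /= mulr1.
have pm : r = 1 \/ r = -1.
  by move/eqP: rr; rewrite sqrf_eq1 => /orP[/eqP|/eqP]; [left|right].
exists q, r; split=> //.
  (* Conjugation preserves the trace and [Z] is traceless, which excludes the identity. *)
  move=> qI; have := congr1 mxtrace E.
  rewrite mxtrace_mulC mulmxA uU' mul1mx mxtrace_pmx // qI mxtraceZ mxtrace1 => /esym/eqP.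
  by rewrite mulf_eq0 pnatr_eq0 orbF; case: pm => -> ; rewrite ?oppr_eq0 oner_eq0.
by rewrite -[in RHS]Eq -scalemxAl scalerA -expr2 rr scale1r.
Qed.

Lemma pauli_rot_kron m (P : m.-tuple pauli) s theta Psi phi :
  pauli_rot theta (rcons_tuple P s) *m kron Psi phi =
  (cos theta)%:C *: kron Psi phi +
  (- 'i%R * (sin theta)%:C) *: kron (pstring P *m Psi) (pmx s *m phi).
Proof.
by rewrite /pauli_rot mulmxDl -!scalemxAl mul1mx pstring_rcons kr2_kron.
Qed.

Lemma kr2_1_pmx_phased m p : phased_pauli (kr2 (m := m) 1%:M (pmx p)).
Proof.
rewrite -pstring_nseqI -pstring_rcons; exact: phased_pstring.
Qed.

Lemma kr2_pstring_1_phased m (P : m.-tuple pauli) : phased_pauli (kr2 (pstring P) 1%:M).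
Proof.
have <- : pmx PauliI = 1%:M by [].
rewrite -pstring_rcons; exact: phased_pstring.
Qed.

Lemma clifford1 n : clifford (1%:M : 'M[C]_(2 ^ n)).
Proof.
split=> [|Q]; first by rewrite /unitary adjmx1 mulmx1.
by exists 0%N, Q; rewrite adjmx1 mulmx1 mul1mx expr0 scale1r.
Qed.

Lemma eigen_disentangle m (P : m.-tuple pauli) s theta phi p (r : C) :
  s <> PauliI -> p <> PauliI -> r = 1 \/ r = -1 -> pmx p *m phi = r *: phi ->
  exists U, clifford U /\ forall Psi,
    product_state (U *m pauli_rot theta (rcons_tuple P s) *m kron Psi phi).
Proof.
move=> sI pI pm Ephi.
have rr : r * r = 1 by case: pm => ->; ring.
case: (pauli_eq_dec p s) => [<-|ps].
  exists 1%:M; split=> [|Psi]; first exact: clifford1.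
  rewrite mul1mx pauli_rot_kron Ephi !kronE.
  exists ((cos theta)%:C *: Psi + (- 'i%R * (sin theta)%:C * r) *: (pstring P *m Psi)), phi.
  by rewrite kronE krmxDl !krmxZl krmxZr scalerA.
(* The factor [r] makes [phi] a +1 eigenvector, so that the gate leaves its branch alone. *)
pose A := r *: kr2 (m := m) 1%:M (pmx p); pose B := kr2 (pstring P) 1%:M.
exists (controlled A B); split.
  apply: clifford_controlled.
  - by rewrite /A -scalemxAl -scalemxAr scalerA rr scale1r kr2M mulmx1 pmx_sqr kr21.
  - by rewrite kr2M mulmx1 pstring_sqr kr21.
  - by rewrite /A -scalemxAl -scalemxAr !kr2M !mul1mx !mulmx1.
  - rewrite /A adjmxZ adj_kr2 adjmx1 adj_pmx; congr (_ *: _).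
    by case: pm => ->; apply/eqP; rewrite eq_complex /= ?oppr0 !eqxx.
  - by rewrite adj_kr2 adj_pstring adjmx1.
  - exact: phased_pauliZ pm (kr2_1_pmx_phased _ _).
  - exact: kr2_pstring_1_phased.
move=> Psi; rewrite -mulmxA pauli_rot_kron mulmxDr -!scalemxAr.
(* [t] is the eigenvalue of [r *: pmx p]: it is 1 on [phi], and -1 on [pmx s *m phi] by
   anticommutation. *)
have UE Psi' phi' (t : C) : r *: (pmx p *m phi') = t *: phi' ->
    controlled A B *m kron Psi' phi' = 2^-1 *: ((1 + t) *: kron Psi' phi') +
    2^-1 *: ((1 - t) *: kron (pstring P *m Psi') phi').
  move=> Et; rewrite /controlled /span4 !mulmxDl -!scalemxAl -mulmxA mul1mx.
  rewrite /B !kr2_kron !mul1mx.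
  have Ek u : r *: kron u (pmx p *m phi') = t *: kron u phi'.
    by rewrite !kronE -krmxZr Et krmxZr.
  by rewrite !Ek; apply/matrixP=> i j; rewrite !mxE; ring.
rewrite (UE _ _ 1); last by rewrite Ephi scalerA rr.
rewrite (UE _ _ (-1)); last first.
  rewrite mulmxA pmx_anticomm // mulNmx -mulmxA Ephi -scalemxAr scalerN scalerA.
  by rewrite rr scaleN1r scale1r.
rewrite mulmxA pstring_sqr mul1mx subrr opprK !scale0r !scaler0 addr0 add0r.
exists Psi, ((cos theta)%:C *: phi + (- 'i%R * (sin theta)%:C) *: (pmx s *m phi)).
rewrite [RHS]kronE krmxDr !krmxZr -!kronE; congr (_ *: _ + _ *: _);
  rewrite scalerA mulVf ?scale1r ?pnatr_eq0 //.
Qed.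

(** Take [q] anticommuting with [p]. The matrix with columns [phi] and [pmx q *m phi] is unitary and
    conjugates [Z] to [r *: pmx p] and [X] to [pmx q], hence is Clifford. *)
Lemma clifford_of_projector (phi : 'cV[C]_2) p (r : C) :
  p <> PauliI -> r = 1 \/ r = -1 ->
  2 *: (phi *m adj phi) = 1%:M + r *: pmx p -> stabilizer_state1 phi.
Proof.
move=> pI pm E.
have [q qI qp] : exists2 q, q <> PauliI & q <> p.
  by case: p pI {E} => // _; [exists PauliY | exists PauliX | exists PauliX].
have E1 : 2 *: ((pmx q *m phi) *m adj (pmx q *m phi)) = 1%:M - r *: pmx p.
  rewrite adjmxM adj_pmx -!mulmxA [phi *m _]mulmxA scalemxAr scalemxAl E.
  rewrite mulmxDl mulmxDr mul1mx pmx_sqr -scalemxAl -scalemxAr mulmxA (pmx_anticomm qI pI qp).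
  by rewrite mulNmx -mulmxA pmx_sqr mulmx1 scalerN.
have E01 : 2 *: (phi *m adj (pmx q *m phi) + pmx q *m phi *m adj phi) = 2 *: pmx q.
  rewrite adjmxM adj_pmx mulmxA -[pmx q *m phi *m _]mulmxA scalerDr scalemxAl E scalemxAr E.
  rewrite mulmxDl mulmxDr mul1mx mulmx1 -scalemxAl -scalemxAr (pmx_anticomm qI pI qp).
  by apply/matrixP=> i j; rewrite !mxE; ring.
pose u0 := phi; pose u1 := pmx q *m phi.
pose U : 'M[C]_2 := \matrix_(i, j) (if j == 0 then u0 i 0 else u1 i 0).
(* Conjugation by [U] sends matrix units to outer products of its columns, which [E], [E1] and [E01]
   evaluate. *)
have UM (M : 'M[C]_2) : U *m M *m adj U = M 0 0 *: (u0 *m adj u0) +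
    M 0 1 *: (u0 *m adj u1) + M 1 0 *: (u1 *m adj u0) + M 1 1 *: (u1 *m adj u1).
  apply/matrixP=> i j; rewrite !(mulmx2E, mxE) !big_ord1 /u1 !mxE /=.
  rewrite !big_ord_recl !big_ord0; ring.
have two0 : (2 : C) != 0 by rewrite pnatr_eq0.
have UI : U *m adj U = 1%:M.
  have := UM 1%:M; rewrite mulmx1 => ->; rewrite !mxE /= scale1r !scale0r !addr0 scale1r.
  apply: (scalerI two0); rewrite scalerDr E E1.
  by apply/matrixP=> i j; rewrite !mxE; ring.
have UZ : U *m pmx PauliZ *m adj U = r *: pmx p.
  rewrite UM !mxE /= scale1r !scale0r !addr0 scaleN1r.
  apply: (scalerI two0); rewrite scalerBr E E1.
  by apply/matrixP=> i j; rewrite !mxE; ring.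
have UX : U *m pmx PauliX *m adj U = pmx q.
  rewrite UM !mxE /= !scale1r !scale0r add0r addr0.
  by apply: (scalerI two0); rewrite E01.
have UY : U *m pmx PauliY *m adj U = 'i%R *: (pmx q *m (r *: pmx p)).
  (* Since [Y = i X Z], its image follows from those of [X] and [Z]. *)
  have -> : pmx PauliY = 'i%R *: (pmx PauliX *m pmx PauliZ) by pauli_entries; ring: sqri.
  rewrite -UX -UZ -scalemxAr -scalemxAl -!mulmxA [adj U *m (U *m _)]mulmxA.
  by rewrite (mulmx1C UI) mul1mx.
exists U; split; last first.
  apply/matrixP=> i j; rewrite !mxE !big_ord_recl big_ord0 !mxE /=.
  by rewrite (ord1 j); ring.
split; first exact: UI.
have pauli1 (s : pauli) : phased_pauli (n := 1) (pmx s).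
  by exists 0%N, [tuple s]; rewrite expr0 scale1r pstring1.
move=> Q; rewrite pstring1; case: (tnth Q ord0).
- by rewrite mulmx1 UI; exact: (pauli1 PauliI).
- by rewrite UX; exact: pauli1.
- rewrite UY; case: (phased_pauliM (pauli1 q) (phased_pauliZ pm (pauli1 p))) => k [S ES].
  by exists k.+1, S; rewrite exprS -scalerA -ES.
- by rewrite UZ; exact: (phased_pauliZ pm (pauli1 p)).
Qed.

(** * Product vectors, isometries with product outputs, and copies of [M_2] *)

(** Vanishing of all 2 by 2 minors, as a boolean. The zero vector is parallel to everything, so
    transitivity requires a nonzero middle vector. *)
Definition parallel n (u v : 'cV[C]_n) :=
  [forall i, [forall j, u i 0 * v j 0 == u j 0 * v i 0]].

Lemma parallelP n (u v : 'cV[C]_n) :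
  reflect (forall i j, u i 0 * v j 0 = u j 0 * v i 0) (parallel u v).
Proof.
apply: (iffP forallP) => [H i j|H i]; first by have /forallP/(_ j)/eqP := H i.
by apply/forallP => j; apply/eqP.
Qed.

Lemma parallel_sym n (u v : 'cV[C]_n) : parallel u v -> parallel v u.
Proof.
by move/parallelP=> H; apply/parallelP=> i j; rewrite mulrC -H mulrC.
Qed.

Lemma cV_neq0 n (u : 'cV[C]_n) : u != 0 -> exists k, u k 0 != 0.
Proof.
case: (pickP (fun k => u k 0 != 0)) => [k uk|H]; first by exists k.
case/eqP; apply/matrixP=> i j; rewrite (ord1 j) [RHS]mxE.
by have /negbFE/eqP := H i.
Qed.

Lemma parallel_trans n (v u w : 'cV[C]_n) :
  v != 0 -> parallel u v -> parallel v w -> parallel u w.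
Proof.
move=> /cV_neq0[k vk] /parallelP uv /parallelP vw; apply/parallelP=> i j.
apply: (mulfI (mulf_neq0 vk vk)).
have E a b : v k 0 * v k 0 * (u a 0 * w b 0) = (u k 0 * w k 0) * (v a 0 * v b 0).
  by transitivity ((u a 0 * v k 0) * (v k 0 * w b 0)); [ring | rewrite uv vw; ring].
by rewrite !E [v j 0 * _]mulrC.
Qed.

Lemma parallel_scale n (u v : 'cV[C]_n) : v != 0 -> parallel u v ->
  exists c, u = c *: v.
Proof.
move=> /cV_neq0[k vk] /parallelP uv; exists (u k 0 / v k 0).
apply/matrixP=> i j; rewrite (ord1 j) mxE mulrAC -uv.
by rewrite mulfK.
Qed.

Lemma parallel_cancel n (c d : C) (u v : 'cV[C]_n) :
  c != 0 -> d != 0 -> parallel (c *: u) (d *: v) -> parallel u v.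
Proof.
move=> c0 d0 /parallelP uv; apply/parallelP=> i j.
apply: (mulfI (mulf_neq0 c0 d0)); have := uv i j.
by rewrite !mxE mulrACA [c * u j 0 * _]mulrACA.
Qed.

(** Seen as a matrix, a product vector has rank at most 1, so its 2 by 2 minors vanish; a minor of
    the left-hand side factors as a minor of [(u1, u2)] times one of [(w1, w2)]. *)
Lemma product_sum_parallel m (u1 u2 u : 'cV[C]_(2 ^ m)) (w1 w2 w : 'cV[C]_2) :
  kron u1 w1 + kron u2 w2 = kron u w -> parallel u1 u2 || parallel w1 w2.
Proof.
move=> E.
have {}E i j : u1 i 0 * w1 j 0 + u2 i 0 * w2 j 0 = u i 0 * w j 0.
  have : u1 *t w1 + u2 *t w2 = u *t w.
    move: E; rewrite /kron; case: _ / (esym (expnSr 2 m)).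
    by rewrite (eq_irrelevance (muln1 1) erefl) !castmx_id.
  by move=> /matrixP/(_ (mxtens_index (i, j)) (mxtens_index (0, 0))); rewrite mxE !tensmxE.
have M i i' j j' : (u1 i 0 * u2 i' 0 - u1 i' 0 * u2 i 0) *
    (w1 j 0 * w2 j' 0 - w1 j' 0 * w2 j 0) = 0.
  transitivity ((u1 i 0 * w1 j 0 + u2 i 0 * w2 j 0) * (u1 i' 0 * w1 j' 0 + u2 i' 0 * w2 j' 0)
    - (u1 i 0 * w1 j' 0 + u2 i 0 * w2 j' 0) * (u1 i' 0 * w1 j 0 + u2 i' 0 * w2 j 0)).
    by ring.
  by rewrite !E; ring.
case: (boolP (parallel u1 u2)) => //= /forallPn[i /forallPn[i' ne]].
apply/parallelP=> j j'; apply/eqP; rewrite -subr_eq0.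
have /eqP := M i i' j j'; rewrite mulf_eq0 => /orP[|].
  by move=> e; case/negP: ne; rewrite -subr_eq0.
by [].
Qed.

(** If [w i] and [w j] are not parallel, then no [w k] is parallel to both, so every [u k] is
    parallel to [u i] or [u j], and these two are parallel to each other. *)
Lemma parallel_family N a b (u : 'I_N -> 'cV[C]_a) (w : 'I_N -> 'cV[C]_b) :
  (forall i, u i != 0) -> (forall i, w i != 0) ->
  (forall i j, parallel (u i) (u j) || parallel (w i) (w j)) ->
  (forall i j, parallel (u i) (u j)) \/ (forall i j, parallel (w i) (w j)).
Proof.
move=> u0 w0 uw.
case: (boolP [forall i, [forall j, parallel (w i) (w j)]]) => [/forallP H|].
  by right=> i j; have /forallP := H i.
case/forallPn=> i /forallPn[j nw]; left.
have uij : parallel (u i) (u j) by have := uw i j; rewrite (negPf nw) orbF.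
have ui k : parallel (u k) (u i).
  case/orP: (uw k i) => [//|wki]; case/orP: (uw k j) => [ukj|wkj].
    exact: parallel_trans (u0 j) ukj (parallel_sym uij).
  by case/negP: nw; exact: parallel_trans (w0 k) (parallel_sym wki) wkj.
by move=> k l; exact: parallel_trans (u0 i) (ui k) (parallel_sym (ui l)).
Qed.

Lemma is_stateE d (v : 'cV[C]_d) : is_state v -> v != 0.
Proof.
move=> sv; apply/eqP=> v0; move: sv; rewrite /is_state v0 mulmx0 => /matrixP/(_ 0 0).
by rewrite !mxE => /esym/eqP; rewrite oner_eq0.
Qed.

Lemma eq_mx_delta a b (F G : 'M[C]_(a, b)) :
  (forall i, F *m (delta_mx i 0 : 'cV_b) = G *m delta_mx i 0) -> F = G.
Proof.
move=> H; apply/matrixP=> r i; have /matrixP/(_ r 0) := H i.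
by rewrite -!colE !mxE.
Qed.

Lemma product_isometry m (F : 'M[C]_(2 ^ m.+1, 2 ^ m)) :
  adj F *m F = 1%:M -> (forall Psi, is_state Psi -> product_state (F *m Psi)) ->
  (exists V w, F = krmx (m := m) (muln1 _) V w) \/
  (exists u W, F = krmx (m := m) (mul1n _) u W).
Proof.
move=> FF Fprod.
pose d i : 'cV[C]_(2 ^ m) := delta_mx i 0.
have adjd i : adj (d i) = delta_mx 0 i.
  by apply/matrixP=> a b; rewrite !mxE andbC; exact: conjc_nat.
have dd i j : adj (d i) *m d j = (i == j)%:R%:M.
  rewrite adjd; have [<-|ne] := eqVneq i j; last by rewrite mul_delta_mx_0 // raddf0.
  by rewrite mul_delta_mx; apply/matrixP=> a b; rewrite (ord1 a) (ord1 b) !mxE.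
have sd i : is_state (d i) by rewrite /is_state dd eqxx.
have /fin_all_exists[u /fin_all_exists[w E]] i := Fprod _ (sd i).
have sF i : is_state (F *m d i).
  by rewrite /is_state adjmxM -mulmxA [adj F *m (F *m _)]mulmxA FF mul1mx dd eqxx.
have u0 i : u i != 0.
  apply/eqP=> u0; have := is_stateE (sF i).
  by rewrite E u0 kronE -(scale0r 0) krmxZl scale0r eqxx.
have w0 i : w i != 0.
  apply/eqP=> w0; have := is_stateE (sF i).
  by rewrite E w0 kronE -(scale0r 0) krmxZr scale0r eqxx.
have uw i j : parallel (u i) (u j) || parallel (w i) (w j).
  have [<-|ij] := eqVneq i j.
    by apply/orP; left; apply/parallelP=> a b; rewrite mulrC.
  have five : (5 : C) != 0 by rewrite pnatr_eq0.
  have conj5 k : conjc (k%:R / 5 : C) = k%:R / 5.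
    have -> : conjc (k%:R / 5 : C) = conjc k%:R * conjc 5^-1 by exact: rmorphM.
    by rewrite conjc_inv !conjc_nat.
  (* A rational point of the unit circle avoids normalizing by a square root. *)
  have /Fprod[u' [w']] : is_state ((3 / 5 : C) *: d i + (4 / 5 : C) *: d j).
    rewrite /is_state adjmxD !adjmxZ mulmxDl !mulmxDr -!scalemxAl -!scalemxAr !dd !eqxx.
    have ji : (j == i) = false by rewrite eq_sym (negPf ij).
    rewrite (negPf ij) ji !conj5.
    by apply/matrixP=> a b; rewrite (ord1 a) (ord1 b) !mxE eqxx /= !mulr1n; field.
  rewrite mulmxDr -!scalemxAr !E !kronE -!krmxZl -!kronE => /product_sum_parallel.
  case/orP=> [/parallel_cancel->|->]; rewrite ?orbT //.
    by rewrite mulf_neq0 ?invr_neq0 ?pnatr_eq0.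
  by rewrite mulf_neq0 ?invr_neq0 ?pnatr_eq0.
have m0 : (0 < 2 ^ m)%N by rewrite expn_gt0.
pose i0 := Ordinal m0.
case: (parallel_family u0 w0 uw) => par; [right|left].
  have /fin_all_exists[c Ec] i := parallel_scale (u0 i0) (par i i0).
  (* The proportionality constants are absorbed into the varying factor. *)
  exists (u i0), (\matrix_(r, i) (c i * w i r 0)).
  apply: eq_mx_delta => i; rewrite krmx_mull E Ec.
  rewrite (eq_irrelevance (mul1n 1) (muln1 1)) kronE krmxZl -krmxZr; congr krmx.
  by rewrite -colE; apply/matrixP=> r k; rewrite (ord1 k) !mxE.
have /fin_all_exists[c Ec] i := parallel_scale (w0 i0) (par i i0).
exists (\matrix_(r, i) (c i * u i r 0)), (w i0).
apply: eq_mx_delta => i; rewrite krmx_mulr E Ec.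
rewrite kronE krmxZr -krmxZl; congr krmx.
by rewrite -colE; apply/matrixP=> r k; rewrite (ord1 k) !mxE.
Qed.

(** Up to a scalar, the varying factor is itself an isometry. As a square matrix it is then a
    multiple of a unitary, so the range projection is the identity on that side. *)
Lemma product_isometry_range m (F : 'M[C]_(2 ^ m.+1, 2 ^ m)) :
  (0 < m)%N -> adj F *m F = 1%:M ->
  (forall Psi, is_state Psi -> product_state (F *m Psi)) ->
  (exists Y, F *m adj F = kr2 1%:M Y) \/
  (m = 1%N /\ exists X, F *m adj F = kr2 X 1%:M).
Proof.
move=> m0 FF /(product_isometry FF)[[V [w EF]]|[u [W EF]]].
  left; move: FF; rewrite EF krmx_adj adj_krmx [adj w *m w]mx11_scalar.
  set s := (_ 0 0); rewrite tens_mx_scalar castmx_comp.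
  rewrite (eq_irrelevance (etrans _ _) erefl) castmx_id scalemxAl => /mulmx1C.
  rewrite -scalemxAr => VV; exists (s^-1 *: (w *m adj w)).
  have s0 : s != 0.
    apply/eqP=> s0; move: VV; rewrite s0 scale0r => /matrixP.
    have lt0 : (0 < 2 ^ m)%N by rewrite expn_gt0.
    move/(_ (Ordinal lt0) (Ordinal lt0)).
    by rewrite !mxE eqxx => /esym/eqP; rewrite oner_eq0.
  by rewrite -VV /kr2 krmxZl krmxZr scalerA mulfV // scale1r.
right; move: FF; rewrite EF krmx_adj adj_krmx [adj u *m u]mx11_scalar.
set s := (_ 0 0); rewrite tens_scalar_mx castmx_comp.
rewrite (eq_irrelevance (etrans _ _) erefl) castmx_id scalemxAl => WW.
(* [W] has two rows and its [2 ^ m] columns are independent, so [2 ^ m <= 2]. *)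
have m1 : m = 1%N.
  have := mulmx1_min WW; rewrite -[X in (_ <= X)%N](expn1 2) leq_exp2l // => m1.
  by apply/eqP; rewrite eqn_leq m1.
split=> //; subst m; have := mulmx1C (WW : (_ : 'M_2) *m _ = 1%:M).
rewrite -scalemxAr => WW'; exists (s^-1 *: (u *m adj u)).
have s0 : s != 0.
  apply/eqP=> s0; move: WW'; rewrite s0 scale0r => /matrixP/(_ 0 0).
  by rewrite !mxE => /esym/eqP; rewrite oner_eq0.
by rewrite -WW' /kr2 krmxZl krmxZr scalerA mulVf // scale1r.
Qed.

(* Traceless X, Y in M_2 satisfy XY + YX = tr (XY).  Hence the image of P
   anticommutes with those of Q1, Q2 and Q1 Q2; but anticommuting with the first
   two makes it commute with the third. *)
Lemma no_qubit_embedding N (U P Q1 Q2 Q3 : 'M[C]_N) (iota : 'M[C]_2 -> 'M[C]_N)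
    (kappa : C) (b1 b2 b3 : 'M[C]_2) :
  (0 < N)%N -> kappa != 0 -> iota 0 = 0 ->
  (forall X Y, iota (X *m Y) = iota X *m iota Y) ->
  (forall X, \tr (iota X) = kappa * \tr X) ->
  adj U *m U = 1%:M ->
  U *m Q1 *m adj U = iota b1 -> U *m Q2 *m adj U = iota b2 ->
  U *m Q3 *m adj U = iota b3 ->
  P = Q2 *m Q3 -> P *m P = 1%:M -> Q1 *m Q1 = 1%:M -> Q2 *m Q2 = 1%:M ->
  \tr Q1 = 0 -> \tr Q2 = 0 -> \tr (Q1 *m Q2) = 0 -> \tr P = 0 ->
  \tr (P *m Q1) = 0 -> \tr (P *m Q2) = 0 -> \tr (P *m (Q1 *m Q2)) = 0 -> False.
Proof.
move=> N0 k0 i0 iM itr UU E1 E2 E3 EP PP Q11 Q22 t1 t2 t12 tP tP1 tP2 tP12.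
have conjM X Y x y : U *m X *m adj U = iota x -> U *m Y *m adj U = iota y ->
    U *m (X *m Y) *m adj U = iota (x *m y).
  by move=> Ex Ey; rewrite iM -Ex -Ey -!mulmxA [adj U *m (U *m _)]mulmxA UU mul1mx.
have tr0 X x : U *m X *m adj U = iota x -> \tr X = 0 -> \tr x = 0.
  move=> Ex X0; apply: (mulfI k0).
  by rewrite -itr -Ex mxtrace_mulC mulmxA UU mul1mx X0 mulr0.
have EPb := conjM _ _ _ _ E2 E3; rewrite -EP in EPb.
set b := b2 *m b3 in EPb.
have E12 := conjM _ _ _ _ E1 E2.
have trb := tr0 _ _ EPb tP.
have A1 := traceless_anticomm trb (tr0 _ _ E1 t1).
have A2 := traceless_anticomm trb (tr0 _ _ E2 t2).
have A12 := traceless_anticomm trb (tr0 _ _ E12 t12).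
rewrite (tr0 _ _ (conjM _ _ _ _ EPb E1) tP1) raddf0 in A1.
rewrite (tr0 _ _ (conjM _ _ _ _ EPb E2) tP2) raddf0 in A2.
rewrite (tr0 _ _ (conjM _ _ _ _ EPb E12) tP12) raddf0 in A12.
have comm : b *m (b1 *m b2) = b1 *m b2 *m b.
  move/eqP: A1; rewrite addr_eq0 => /eqP A1; move/eqP: A2; rewrite addr_eq0 => /eqP A2.
  by rewrite mulmxA A1 mulNmx -(mulmxA b1 b) A2 mulmxN opprK mulmxA.
(* [b] both commutes and anticommutes with [b1 *m b2]. *)
have z : b *m (b1 *m b2) = 0.
  move/eqP: A12; rewrite -comm -mulr2n -scaler_nat scaler_eq0 pnatr_eq0 /=.
  by move/eqP.
have := conjM _ _ _ _ EPb E12; rewrite z i0 => Z.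
have {}Z : P *m (Q1 *m Q2) = 0.
  transitivity (adj U *m (U *m (P *m (Q1 *m Q2)) *m adj U) *m U).
    by rewrite !mulmxA UU mul1mx -!mulmxA UU mulmx1.
  by rewrite Z mulmx0 mul0mx.
(* [P], [Q1] and [Q2] are involutions, so their product is invertible and cannot vanish. *)
have : (1%:M : 'M[C]_N) = 0.
  have <- : P *m (Q1 *m Q2) *m (Q2 *m Q1) *m P = 1%:M.
    rewrite -!mulmxA [Q2 *m (Q2 *m _)]mulmxA Q22 mul1mx.
    by rewrite [Q1 *m (Q1 *m _)]mulmxA Q11 mul1mx PP.
  by rewrite Z !mul0mx.
move=> /matrixP/(_ (Ordinal N0) (Ordinal N0)).
by rewrite !mxE eqxx => /eqP; rewrite oner_eq0.
Qed.

(** * Conjugation by the rotation *)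

Section Rotation.
Variables (n : nat) (P : n.-tuple pauli) (theta : R).
Let c : C := (cos theta)%:C.
Let s : C := (sin theta)%:C.
Let Rot := pauli_rot theta P.

Lemma rot_cos_sin : c * c + s * s = 1.
Proof.
have E : (cos theta * cos theta + sin theta * sin theta = 1)%R.
  by have := sin2_cos2 theta; rewrite /Rsqr => E; rewrite addrC; exact: E.
rewrite /c /s -!(rmorphM (real_complex R)) -(rmorphD (real_complex R)).
by rewrite E rmorph1.
Qed.

Lemma adj_pauli_rot : adj Rot = c *: 1%:M + ('i%R * s) *: pstring P.
Proof.
rewrite /Rot /pauli_rot adjmxD !adjmxZ adjmx1 adj_pstring.
have -> : conjc (- 'i%R * (sin theta)%:C) = conjc (- 'i%R) * conjc (sin theta)%:C.
  exact: rmorphM.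
have -> : conjc (- 'i%R : C) = - conjc 'i%R by exact: rmorphN.
by rewrite conj_i opprK !conjc_real.
Qed.

Lemma pauli_rot_unitary : adj Rot *m Rot = 1%:M.
Proof.
rewrite adj_pauli_rot /Rot /pauli_rot -/c -/s.
rewrite !(mulmxDl, mulmxDr) -!scalemxAl -!scalemxAr !(mulmx1, mul1mx) pstring_sqr !scalerA.
rewrite -[RHS]scale1r -rot_cos_sin.
by apply/matrixP=> i j; rewrite !mxE; ring: sqri.
Qed.

(** The coefficients are [cos (2 theta)] and [- i sin (2 theta)], kept as polynomials in [c] and
    [s]. *)
Lemma pauli_rot_sqr :
  Rot *m Rot = (c * c - s * s) *: 1%:M - ('i%R * (2 * (c * s))) *: pstring P.
Proof.
rewrite /Rot /pauli_rot -/c -/s.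
rewrite !(mulmxDl, mulmxDr) -!scalemxAl -!scalemxAr !(mulmx1, mul1mx) pstring_sqr !scalerA.
by apply/matrixP=> i j; rewrite !mxE; ring: sqri.
Qed.

Lemma rot_comm (Q : 'M[C]_(2 ^ n)) : Q *m pstring P = pstring P *m Q ->
  Q *m Rot = Rot *m Q.
Proof.
move=> QP; rewrite /Rot /pauli_rot mulmxDr mulmxDl -!scalemxAl -!scalemxAr QP.
by rewrite mulmx1 mul1mx.
Qed.

Lemma rot_anticomm (Q : 'M[C]_(2 ^ n)) : Q *m pstring P = - (pstring P *m Q) ->
  Q *m Rot = adj Rot *m Q.
Proof.
move=> QP; rewrite adj_pauli_rot /Rot /pauli_rot mulmxDr mulmxDl -!scalemxAl -!scalemxAr QP.
by rewrite mulmx1 mul1mx scalerN mulNr scaleNr opprK.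
Qed.

Lemma rot_anticomm_adj (Q : 'M[C]_(2 ^ n)) : Q *m pstring P = - (pstring P *m Q) ->
  Q *m adj Rot = Rot *m Q.
Proof.
move=> QP; rewrite adj_pauli_rot /Rot /pauli_rot mulmxDr mulmxDl -!scalemxAl -!scalemxAr QP.
by rewrite mulmx1 mul1mx scalerN mulNr scaleNr.
Qed.

(** If [cos (2 theta)] or [sin (2 theta)] vanishes, the other is 1 or -1, and [Rot *m Rot] is a
    phased Pauli string, which makes [Rot] Clifford. *)
Lemma not_clifford_rot : ~ clifford Rot ->
  c * c - s * s != 0 /\ 'i%R * (2 * (c * s)) != 0.
Proof.
move=> ncl.
have uR : Rot *m adj Rot = 1%:M := mulmx1C pauli_rot_unitary.
have i0 : ('i%R : C) != 0 by exact: neq0Ci.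
have sq1 (x : C) : x * x = 1 -> x = 1 \/ x = -1.
  by move/eqP; rewrite -expr2 sqrf_eq1 => /orP[/eqP|/eqP]; [left|right].
have xy : (c * c - s * s) * (c * c - s * s) + 2 * (c * s) * (2 * (c * s)) = 1.
  transitivity ((c * c + s * s) * (c * c + s * s)); first by ring.
  by rewrite rot_cos_sin mulr1.
(* Conjugation by [Rot] fixes [Q] if it commutes with [P], and gives [Rot *m Rot *m Q] if it
   anticommutes. *)
have conj_sqr : ~ forall Q : n.-tuple pauli, phased_pauli (Rot *m Rot *m pstring Q).
  move=> RR; apply: ncl; split=> // Q.
  have [e [He|He] QP] := pstring_comm Q P.
    exists 0%N, Q; rewrite -rot_comm; last by rewrite QP He scale1r.
    by rewrite -mulmxA uR mulmx1 expr0 scale1r.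
  rewrite -mulmxA rot_anticomm_adj; last by rewrite QP He scaleN1r.
  by rewrite mulmxA; exact: RR.
move: xy pauli_rot_sqr; set x := c * c - s * s; set y := 2 * (c * s) => xy RR.
split; apply/eqP=> z0; apply: conj_sqr => Q; rewrite RR.
  have Hy : y = 1 \/ y = -1 by apply: sq1; rewrite -xy z0 mulr0 add0r.
  rewrite z0 scale0r sub0r mulNmx -scalemxAl mulrC -scalerA.
  apply: phased_pauliN; apply: (phased_pauliZ Hy).
  have [k [S ES]] := pstring_mul P Q.
  by exists k.+1, S; rewrite ES scalerA exprS.
have y0 : y = 0 by move/eqP: z0; rewrite mulf_eq0 (negPf i0) => /eqP.
have Hx : x = 1 \/ x = -1 by apply: sq1; rewrite -xy y0 mulr0 addr0.
rewrite z0 scale0r subr0 -scalemxAl mul1mx.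
exact: (phased_pauliZ Hx (phased_pstring Q)).
Qed.

Variables (U D : 'M[C]_(2 ^ n)).
Hypothesis UU : adj U *m U = 1%:M.

(** Cyclicity of the trace moves the evolution from [D] to the observable [Q]. *)
Lemma mxtrace_conj_rot (Q : 'M[C]_(2 ^ n)) :
  \tr (U *m Q *m adj U *m (U *m Rot *m D *m adj (U *m Rot))) =
  \tr (adj Rot *m Q *m Rot *m D).
Proof.
rewrite adjmxM !mulmxA -(mulmxA (U *m Q) (adj U)) UU mulmx1.
rewrite mxtrace_mulC !mulmxA UU mul1mx mxtrace_mulC !mulmxA.
by [].
Qed.

Lemma mxtrace_rot_comm (Q : 'M[C]_(2 ^ n)) : Q *m pstring P = pstring P *m Q ->
  \tr (U *m Q *m adj U *m (U *m Rot *m D *m adj (U *m Rot))) = \tr (Q *m D).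
Proof.
move=> QP; rewrite mxtrace_conj_rot -(mulmxA (adj Rot)) rot_comm //.
by rewrite mulmxA pauli_rot_unitary mul1mx.
Qed.

(** Here [adj Rot *m Q *m Rot] is [Q *m (Rot *m Rot)], which brings in the double angle. *)
Lemma mxtrace_rot_anticomm (Q : 'M[C]_(2 ^ n)) :
  Q *m pstring P = - (pstring P *m Q) ->
  \tr (U *m Q *m adj U *m (U *m Rot *m D *m adj (U *m Rot))) =
  (c * c - s * s) * \tr (Q *m D) - ('i%R * (2 * (c * s))) * \tr (Q *m pstring P *m D).
Proof.
move=> QP; rewrite mxtrace_conj_rot -rot_anticomm // -(mulmxA Q) pauli_rot_sqr.
rewrite mulmxBr mulmxBl -!scalemxAr mulmx1 -!scalemxAl raddfB /=.
by rewrite !mxtraceZ.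
Qed.
End Rotation.

(** * From product outputs to a single Bloch axis *)

(** The copy of [M_2] is the last qubit in the first case and the first qubit in the second; [kappa]
    is the dimension of the other side. Traces factor, so a Pauli string with nonzero trace against
    [D] must be the identity on that other side. *)
Lemma range_embedding m (D : 'M[C]_(2 ^ m.+1)) :
  (exists Y, D = kr2 1%:M Y) \/ (m = 1%N /\ exists X, D = kr2 X 1%:M) ->
  exists (iota : 'M[C]_2 -> 'M[C]_(2 ^ m.+1)) (kappa : C),
  [/\ kappa != 0, iota 0 = 0, forall X Y, iota (X *m Y) = iota X *m iota Y,
      forall X, \tr (iota X) = kappa * \tr X &
      forall X, phased_pauli X -> \tr (X *m D) != 0 -> exists b, X = iota b].
Proof.
have tr1 k : (k%:R == 0 :> C) = (k == 0)%N by rewrite pnatr_eq0.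
case=> [[Y ->]|[m1 [X ->]]].
  exists (kr2 1%:M), (2 ^ m)%:R; split.
  - by rewrite tr1 expn_eq0.
  - by rewrite -(scale0r 0) /kr2 krmxZr scale0r.
  - by move=> X Z; rewrite kr2M mulmx1.
  - by move=> X; rewrite mxtrace_kr2 mxtrace1.
  move=> _ [k [Q ->]]; have [Q' [-> _]] := tuple_rcons Q; rewrite pstring_rcons.
  rewrite -scalemxAl mxtraceZ kr2M mulmx1 mxtrace_kr2 !mulf_eq0 !negb_or => /and3P[_ /eqP tQ _].
  exists ('i%R ^+ k *: pmx (tnth Q ord_max)).
  by rewrite (pstringI (mxtrace_pstring tQ)) /kr2 krmxZr.
subst m; exists (fun Z : 'M[C]_2 => kr2 (m := 1) Z 1%:M), 2; split.
- by rewrite tr1.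
- by rewrite -(scale0r 0) /kr2 krmxZl scale0r.
- by move=> Z T; rewrite kr2M mulmx1.
- by move=> Z; rewrite mxtrace_kr2 mxtrace1 mulrC.
move=> _ [k [Q ->]]; have [Q' [-> _]] := tuple_rcons Q; rewrite pstring_rcons.
rewrite -scalemxAl mxtraceZ kr2M mulmx1 mxtrace_kr2 !mulf_eq0 !negb_or => /and3P[_ _ tQ].
exists ('i%R ^+ k *: pstring Q').
case: (pauli_eq_dec (tnth Q ord_max) PauliI) tQ => [-> _|nI]; first by rewrite /kr2 krmxZl.
by rewrite mxtrace_pmx // eqxx.
Qed.

Lemma no_two_bloch_axes m (P : m.-tuple pauli) s theta (phi : 'cV[C]_2) U a b :
  (0 < m)%N -> \tr (pstring P) = 0 -> s <> PauliI -> a <> PauliI -> b <> PauliI ->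
  a <> b -> b <> s -> ~ clifford (pauli_rot theta (rcons_tuple P s)) ->
  is_state phi -> clifford U ->
  (forall Psi, is_state Psi ->
     product_state (U *m pauli_rot theta (rcons_tuple P s) *m kron Psi phi)) ->
  \tr (pmx a *m (phi *m adj phi)) != 0 -> \tr (pmx b *m (phi *m adj phi)) != 0 -> False.
Proof.
move=> m0 trP sI aI bI ab bs ncl sphi cU prod ra rb.
have [x0 y0] := not_clifford_rot ncl.
set Rot := pauli_rot theta _ in prod.
have UU : adj U *m U = 1%:M by apply: mulmx1C; case: cU.
(* [K] is the isometry that appends [phi], and [D] below is [K *m adj K]; thus [F *m adj F] is [D]
   conjugated by [U *m Rot]. *)
pose K := krmx (muln1 _) (1%:M : 'M[C]_(2 ^ m)) phi.
have KK : adj K *m K = 1%:M.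
  rewrite adj_krmx sphi adjmx1 mulmx1 tens_mx_scalar scale1r castmx_comp.
  by rewrite (eq_irrelevance (etrans _ _) erefl) castmx_id.
pose D := kr2 (m := m) 1%:M (phi *m adj phi).
pose F := U *m Rot *m K.
have FF : adj F *m F = 1%:M.
  rewrite /F !adjmxM -!mulmxA [adj U *m (U *m _)]mulmxA UU mul1mx.
  by rewrite [adj Rot *m (Rot *m _)]mulmxA pauli_rot_unitary mul1mx KK.
have Fprod Psi : is_state Psi -> product_state (F *m Psi).
  by move=> /prod; rewrite /F -(mulmxA _ K) krmx_mulr mul1mx kronE.
have EF : F *m adj F = U *m Rot *m D *m adj (U *m Rot).
  rewrite /F [adj (_ *m K)]adjmxM !mulmxA -(mulmxA _ K) krmx_adj.
  by rewrite adjmx1 mulmx1.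
have [iota [kappa [k0 i0 iM itr iP]]] := range_embedding (product_isometry_range m0 FF Fprod).
pose Q1 := kr2 (m := m) 1%:M (pmx a); pose Q2 := kr2 (m := m) 1%:M (pmx b).
pose PP := pstring (rcons_tuple P s).
have EP : PP = kr2 (pstring P) (pmx s) by exact: pstring_rcons.
have M0 : ((2 ^ m)%:R : C) != 0 by rewrite pnatr_eq0 expn_eq0.
have trD X p : \tr (kr2 (m := m) X (pmx p) *m D) = \tr X * \tr (pmx p *m (phi *m adj phi)).
  by rewrite kr2M mulmx1 mxtrace_kr2.
have Q22 : Q2 *m Q2 = 1%:M by rewrite kr2M mulmx1 pmx_sqr kr21.
have anti q : q <> PauliI -> q <> s ->
    kr2 (m := m) 1%:M (pmx q) *m PP = - (PP *m kr2 1%:M (pmx q)).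
  move=> qI qs; rewrite EP !kr2M mul1mx mulmx1 pmx_anticomm // -scaleN1r.
  by rewrite {1}/kr2 krmxZr scaleN1r.
have trQPD q : \tr (kr2 (m := m) 1%:M (pmx q) *m PP *m D) = 0.
  by rewrite EP !kr2M mulmx1 mul1mx mxtrace_kr2 trP mul0r.
have axis q : q <> PauliI -> \tr (pmx q *m (phi *m adj phi)) != 0 ->
    exists X, U *m kr2 1%:M (pmx q) *m adj U = iota X.
  move=> qI rq; apply: iP; first exact: clifford_conj (kr2_1_pmx_phased _ _).
  (* For [q = s] the rotation has no effect; otherwise the trace is scaled by [cos (2 theta)], and
     the other term vanishes with the trace of [pstring P]. *)
  rewrite EF; case: (pauli_eq_dec q s) => [qs|qs].
    rewrite mxtrace_rot_comm //; last by rewrite -/PP EP !kr2M qs mul1mx mulmx1.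
    by rewrite trD mxtrace1 mulf_neq0.
  rewrite mxtrace_rot_anticomm //; last exact: anti.
  by rewrite trQPD mulr0 subr0 trD mxtrace1 !mulf_neq0.
have [b1 E1] := axis a aI ra; have [b2 E2] := axis b bI rb.
(* Now the [cos (2 theta)] term vanishes and, as [PP] squares to 1, the other one is [sin (2 theta)]
   times the [b] component, up to a phase. *)
have [b3 E3] : exists X, U *m (Q2 *m PP) *m adj U = iota X.
  apply: iP.
    by apply: clifford_conj (phased_pauliM (kr2_1_pmx_phased _ _) (phased_pstring _)).
  rewrite EF mxtrace_rot_anticomm //; last first.
    by rewrite -/PP {1}(anti b bI bs) mulNmx -mulmxA.
  rewrite trQPD mulr0 sub0r oppr_eq0 -/PP -(mulmxA Q2) pstring_sqr mulmx1 trD mxtrace1.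
  by rewrite mulf_neq0 // mulf_neq0.
apply: (no_qubit_embedding (P := PP) _ k0 i0 iM itr UU E1 E2 E3).
- by rewrite expn_gt0.
- by rewrite mulmxA Q22 mul1mx.
- exact: pstring_sqr.
- by rewrite kr2M mulmx1 pmx_sqr kr21.
- exact: Q22.
- by rewrite mxtrace_kr2 mxtrace_pmx // mulr0.
- by rewrite mxtrace_kr2 mxtrace_pmx // mulr0.
- by rewrite kr2M mxtrace_kr2 mxtrace_pmx_mul // mulr0.
- by rewrite EP mxtrace_kr2 trP mul0r.
- by rewrite EP kr2M mulmx1 mxtrace_kr2 trP mul0r.
- by rewrite EP kr2M mulmx1 mxtrace_kr2 trP mul0r.
- by rewrite EP !kr2M !mulmx1 mxtrace_kr2 trP mul0r.
Qed.

Lemma single_axis_stabilizer (phi : 'cV[C]_2) p :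
  is_state phi -> p <> PauliI ->
  (forall q, q <> PauliI -> q <> p -> \tr (pmx q *m (phi *m adj phi)) = 0) ->
  stabilizer_state1 phi.
Proof.
move=> sphi pI r0; set r := \tr (pmx p *m (phi *m adj phi)).
have tr1 : \tr (phi *m adj phi) = 1 by rewrite mxtrace_mulC sphi mxtrace1.
have E : 2 *: (phi *m adj phi) = 1%:M + r *: pmx p.
  rewrite pauli_expansion tr1 /r.
  case: p pI r0 {r} => // _ r0.
  - by rewrite (r0 PauliY) // (r0 PauliZ) // !scale0r !addr0.
  - by rewrite (r0 PauliX) // (r0 PauliZ) // !scale0r !addr0.
  - by rewrite (r0 PauliX) // (r0 PauliY) // !scale0r !addr0.
(* A pure state has a Bloch vector of length 1: compare the traces in the idempotency of the
   projector. *)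
have rr : r * r = 1.
  have : (1%:M + r *: pmx p) *m (1%:M + r *: pmx p) = 2 *: (1%:M + r *: pmx p).
    rewrite -E -scalemxAl -scalemxAr -mulmxA [adj phi *m (phi *m _)]mulmxA sphi mul1mx.
    by [].
  move=> /(congr1 mxtrace); rewrite !(mulmxDl, mulmxDr) -!scalemxAl -!scalemxAr.
  rewrite pmx_sqr !(mul1mx, mulmx1) !scalerDr !mxtraceD !mxtraceZ mxtrace_pmx // mxtrace1.
  rewrite !mulr0 !addr0 add0r => /eqP; rewrite mulrA -subr_eq0.
  have -> : 2 + r * r * 2 - 2 * 2 = (r * r - 1) * 2 :> C by ring.
  by rewrite mulf_eq0 pnatr_eq0 orbF subr_eq0 => /eqP.
apply: clifford_of_projector E => //.
by move/eqP: rr; rewrite -expr2 sqrf_eq1 => /orP[/eqP|/eqP]; [left|right].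
Qed.

(* n = m.+1 qubits, n >= 2 <-> 1 <= m; qubit n is the last index ord_max *)
Theorem theorem1 (m : nat) (hm : (1 <= m)%N) (P : m.+1.-tuple pauli)
  (theta : R) (phi : 'cV[R[i]]_2) :
  tnth P ord_max <> PauliI ->
  (exists j : 'I_m.+1, j <> ord_max /\ tnth P j <> PauliI) ->
  ~ clifford (pauli_rot theta P) ->
  is_state phi ->
  (exists U : 'M[R[i]]_(2 ^ m.+1), clifford U /\
     forall Psi : 'cV[R[i]]_(2 ^ m), is_state Psi ->
       product_state (U *m pauli_rot theta P *m kron Psi phi))
  <-> stabilizer_state1 phi.
Proof.
move=> sI [j [jmax jI]] ncl sphi.
have [P' [EP EP']] := tuple_rcons P.
set s := tnth P ord_max in sI EP.
(* The non-identity factor at [j] lies among the first [m] qubits. *)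
have trP : \tr (pstring P') = 0.
  have [//|/eqP/mxtrace_pstring PI] := eqVneq (\tr (pstring P')) 0; case: jI.
  have lt_jm : (j < m)%N.
    by rewrite ltn_neqAle -ltnS ltn_ord andbT; apply/eqP=> /(@val_inj _ _ 'I_m.+1 j ord_max).
  by rewrite -(PI (Ordinal lt_jm)) EP'; congr tnth; apply: val_inj.
rewrite EP in ncl *; split; last first.
  move=> /stabilizer_eigen[p [r [pI pm Ephi]]].
  have [U [cU prod]] := eigen_disentangle P' theta sI pI pm Ephi.
  by exists U; split=> // Psi _; apply: prod.
case=> U [cU prod].
pose r p := \tr (pmx p *m (phi *m adj phi)).
have two a b : a <> PauliI -> b <> PauliI -> a <> b -> r a != 0 -> r b = 0.
  move=> aI bI ab ra; have [//|rb] := eqVneq (r b) 0; exfalso.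
  (* The second axis passed to [no_two_bloch_axes] must differ from [s]; at most one of [a] and [b]
     equals [s], so they are swapped if necessary. *)
  case: (pauli_eq_dec b s) => [bs|bs].
    have as' : a <> s by rewrite -bs.
    have ba : b <> a by move=> /esym.
    exact: no_two_bloch_axes hm trP sI bI aI ba as' ncl sphi cU prod rb ra.
  exact: no_two_bloch_axes hm trP sI aI bI ab bs ncl sphi cU prod ra rb.
(* The axis is the first with a nonzero component; [Z] serves once [X] and [Y] are ruled out. *)
have [p pI rp] : exists2 p, p <> PauliI & forall q, q <> PauliI -> q <> p -> r q = 0.
  have [x0|x0] := eqVneq (r PauliX) 0; last first.
    by exists PauliX => // q qI qX; apply: two x0 => // /esym.
  have [y0|y0] := eqVneq (r PauliY) 0; last first.
    by exists PauliY => // q qI qY; apply: two y0 => // /esym.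
  by exists PauliZ => // -[].
exact: single_axis_stabilizer sphi pI rp.
Qed.
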